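(* Let $n\ge 2$, $k\ge 3$, $\kappa\in\{-1,1\}$ and $m_1,\dots,m_n>0$. Let $\mathbf q_1,\dots,\mathbf q_n$ be a rotopulsating orbit of the curved $n$-body problem of the form $$\mathbf q_i(t)=\begin{pmatrix}\rho(t)T(t)\mathbf Q_i\\ Z(t)\end{pmatrix},\qquad i=1,\dots,n.$$ If $\rho$ is non-constant, then the vectors $\mathbf Q_1,\dots,\mathbf Q_n$ form a regular polygon.
   Context: Setting. Let $\kappa\in\{-1,1\}$ be the curvature; put $\sigma=1$ if $\kappa=1$ and $\sigma=-1$ if $\kappa=-1$. For $\mathbf a,\mathbf b\in\mathbb R^m$ ($m\ge 1$) put $\mathbf a\odot_m\mathbf b=a_1b_1+\dots+a_{m-1}b_{m-1}+\sigma a_mb_m$. Let $\mathbf M_\kappa^{k-1}=\{x\in\mathbb R^k:\ \kappa(x_1^2+\dots+x_{k-1}^2+\sigma x_k^2)=1\}$. The curved $n$-body problem with masses $m_1,\dots,m_n>0$ and positions $\mathbf q_i(t)\in\mathbf M_\kappa^{k-1}$ is the system $$\ddot{\mathbf q}_i=\sum_{j\ne i}\frac{m_j[\mathbf q_j-(\sigma\,\mathbf q_i\odot_k\mathbf q_j)\mathbf q_i]}{[\sigma-\sigma(\mathbf q_i\odot_k\mathbf q_j)^2]^{3/2}}-(\sigma\,\dot{\mathbf q}_i\odot_k\dot{\mathbf q}_i)\mathbf q_i,\qquad i=1,\dots,n.$$ A solution is understood on an open interval $I\ni 0$ on which all the denominators are nonzero. A rotopulsating orbit (of the type considered) is a solution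 of this system of the form $\mathbf q_i(t)=\begin{pmatrix}\rho(t)T(t)\mathbf Q_i\\ Z(t)\end{pmatrix}$, $i=1,\dots,n$, where $\rho:I\to[0,\infty)$ is twice continuously differentiable, $T(t)=\begin{pmatrix}\cos\theta(t)&-\sin\theta(t)\\ \sin\theta(t)&\cos\theta(t)\end{pmatrix}$ with $\theta:I\to\mathbb R$ twice continuously differentiable and $\theta(0)=0$, $Z:I\to\mathbb R^{k-2}$ is twice differentiable, and $\mathbf Q_i\in\mathbb R^2$ are constant vectors with Euclidean norm $\|\mathbf Q_i\|_2=1$. The vectors $\mathbf Q_1,\dots,\mathbf Q_n$ form a regular polygon if, up to ordering, they are the vertices of a regular $n$-gon inscribed in the unit circle, i.e. $n$ points equally spaced on the unit circle (two antipodal points if $n=2$). *)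

(* Defs.v *)
From HB Require Import structures.
From mathcomp Require Import all_boot all_order all_algebra all_fingroup.
From mathcomp Require Import all_classical all_reals all_analysis.

Set Implicit Arguments.
Unset Strict Implicit.
Unset Printing Implicit Defensive.

Import Order.TTheory GRing.Theory Num.Theory.
Import numFieldNormedType.Exports.

Local Open Scope classical_set_scope.
Local Open Scope ring_scope.

Section CurvedSpace.
Context {R : realType}.
Implicit Types kappa : R.

Definition sigma kappa : R := if kappa == 1 then 1 else -1.

(* Indices start at 0, so the last coordinate, which carries the sign
   [sigma kappa], is the one with [l.+1 = d]. *)
Definition odot kappa (d : nat) (a b : 'cV[R]_d) : R :=
  \sum_(l < d) (if l.+1 == d then sigma kappa else 1) * (a l 0 * b l 0).

(* The space M_kappa^(d-1), as a subset of R^d. *)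
Definition Mspace kappa (d : nat) : set 'cV[R]_d :=
  [set x | kappa * odot kappa x x = 1].

(* The base of the power is nonnegative when [x] and [y] are in
   [Mspace kappa d], by the (reversed, if kappa = -1) Cauchy-Schwarz
   inequality, so that [powR] is the usual real power. *)
Definition denominator kappa (d : nat) (x y : 'cV[R]_d) : R :=
  (sigma kappa - sigma kappa * odot kappa x y ^+ 2) `^ (3 / 2).

Definition acceleration kappa (n d : nat) (m : 'I_n -> R)
    (x v : 'I_n -> 'cV[R]_d) (i : 'I_n) : 'cV[R]_d :=
  \sum_(j < n | j != i)
     (m j / denominator kappa (x i) (x j)) *:
       (x j - (sigma kappa * odot kappa (x i) (x j)) *: x i)
  - (sigma kappa * odot kappa (v i) (v i)) *: x i.

End CurvedSpace.

Section Orbits.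
Context {R : realType}.
Implicit Types I : set R.

Definition open_interval_at0 I : Prop := [/\ open I, is_interval I & I 0].

(* Functions of time are total; only their values on the open set [I] matter,
   which also determine the derivatives at the points of [I]. *)
Definition twice_differentiable_on I (V : normedModType R) (f : R -> V) : Prop :=
  forall t, I t -> derivable f t 1 /\ derivable (derive1 f) t 1.

Definition C2_on I (V : normedModType R) (f : R -> V) : Prop :=
  twice_differentiable_on I f /\ forall t, I t -> {for t, continuous (derive1n 2 f)}.

Definition curved_nbody_solution (kappa : R) (n d : nat) (m : 'I_n -> R)
    I (q : 'I_n -> R -> 'cV[R]_d) : Prop :=
  [/\ open_interval_at0 I,
      forall i, twice_differentiable_on I (q i),
      forall i t, I t -> Mspace kappa (q i t),
      forall i j t, j != i -> I t -> denominator kappa (q i t) (q j t) != 0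
    & forall i t, I t ->
        derive1n 2 (q i) t =
        acceleration kappa m (fun j => q j t) (fun j => derive1 (q j) t) i].

Definition rotation (a : R) : 'M[R]_2 :=
  \matrix_(i, j) if i == j then cos a
                 else if i == 0 then - sin a else sin a.

Definition norm2 (d : nat) (x : 'cV[R]_d) : R :=
  Num.sqrt (\sum_(l < d) x l 0 ^+ 2).

(* The vector of R^k with first two coordinates [x] and remaining ones [z]. *)
Definition stack (k : nat) (k_ge2 : (2 <= k)%N)
    (x : 'cV[R]_2) (z : 'cV[R]_(k - 2)) : 'cV[R]_k :=
  castmx (subnKC k_ge2, erefl 1%N) (col_mx x z).

Definition rotopulsating (kappa : R) (n k : nat) (k_ge2 : (2 <= k)%N)
    (m : 'I_n -> R) I (q : 'I_n -> R -> 'cV[R]_k) (rho theta : R -> R)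
    (Z : R -> 'cV[R]_(k - 2)) (Q : 'I_n -> 'cV[R]_2) : Prop :=
  [/\ curved_nbody_solution kappa m I q,
      C2_on I rho /\ (forall t, I t -> 0 <= rho t),
      C2_on I theta /\ theta 0 = 0,
      twice_differentiable_on I Z /\ (forall i, norm2 (Q i) = 1)
    & forall i t, I t ->
        q i t = stack k_ge2 (rho t *: (rotation (theta t) *m Q i)) (Z t)].

(* Vertices of a regular n-gon inscribed in the unit circle, up to ordering. *)
Definition regular_polygon (n : nat) (Q : 'I_n -> 'cV[R]_2) : Prop :=
  exists (s : 'S_n) (phi : R), forall j : 'I_n,
    let a := phi + 2 * pi * j%:R / n%:R in
    Q (s j) 0 0 = cos a /\ Q (s j) 1 0 = sin a.

End Orbits.

(* Main.v *)
Require Import Defs.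
From HB Require Import structures.
From mathcomp Require Import all_boot all_order all_algebra all_fingroup.
From mathcomp Require Import all_classical all_reals all_analysis.
From mathcomp Require Import ring lra.

Set Implicit Arguments.
Unset Strict Implicit.
Unset Printing Implicit Defensive.

Import Order.TTheory GRing.Theory Num.Theory.
Import numFieldNormedType.Exports.

Local Open Scope classical_set_scope.
Local Open Scope ring_scope.

(** Write [c i j = 1 - <Q i, Q j>] and [s i j = det (Q i, Q j)].  All planar
    parts of the bodies are fixed rotations of one another, so the expression
    [x y'' - y x''] of the planar part [(x, y)] of a body is the same for all
    bodies.  The equations of motion turn it into the torque
    [rho^2 * sum_j m_j s_ij / D_ij], where [D_ij] is the denominator; the terms
    proportional to [q_i] drop out.  Weighting this common value with the masses
    and summing gives [0], because [s_ij / D_ij] is antisymmetric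
    ([antisymmetric_rows_zero]).  Hence every torque vanishes ([torque_zero]).

    Since all bodies share the component [Z], the constraint that they lie on the
    curved space gives
    [D_ij = (2 rho^2)^(3/2) c_ij^(3/2) (1 - c_ij u)^(3/2)] with
    [u = kappa rho^2 / 2] ([denominator_factor]).  A non-constant continuous [rho]
    makes [u] run through an open interval, where therefore
    [sum_j m_j s_ij c_ij^(-3/2) (1 - c_ij u)^(-3/2) = 0].  The functions
    [u |-> (1 - c u)^(-3/2)] are linearly independent for different [c]
    ([affine_powers_free]), so the sum vanishes over each set of [j] with a given
    [c_ij].  The points at a given distance from [Q i] are at most two, mirror
    images in the line through [0] and [Q i], with opposite [s_ij]; as the masses
    are positive, with a point its mirror image must also be present.

    So the finite set of the [Q j] is stable under the reflections in the lines
    through its own points.  Such a reflection exchanges the two neighbours of the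
    point on its axis, so all gaps between neighbours are equal
    ([reflection_closed_regular]). *)

(** * Plane vectors *)

Definition inner2 (R : realType) (u v : 'cV[R]_2) : R :=
  u 0 0 * v 0 0 + u 1 0 * v 1 0.

Definition cross2 (R : realType) (u v : 'cV[R]_2) : R :=
  u 0 0 * v 1 0 - u 1 0 * v 0 0.

Lemma cV2P (R : realType) (u v : 'cV[R]_2) :
  u 0 0 = v 0 0 -> u 1 0 = v 1 0 -> u = v.
Proof.
move=> uv0 uv1; apply/matrixP => i j; rewrite (ord1 j).
suff [->|->] : i = 0 \/ i = 1 by [].
by case: i => [[|[|//]] i2]; [left|right]; exact: val_inj.
Qed.

Lemma cross2_xx (R : realType) (u : 'cV[R]_2) : cross2 u u = 0.
Proof. by rewrite /cross2 mulrC subrr. Qed.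

Lemma cross2_anti (R : realType) (u v : 'cV[R]_2) : cross2 v u = - cross2 u v.
Proof. by rewrite /cross2; ring. Qed.

Lemma scale_entry (R : realType) (r : R) (w : 'cV[R]_2) i :
  (r *: w) i 0 = r * w i 0.
Proof. by rewrite mxE. Qed.

Lemma rotation0 (R : realType) (a : R) (v : 'cV[R]_2) :
  (rotation a *m v) 0 0 = cos a * v 0 0 - sin a * v 1 0.
Proof.
rewrite mxE !big_ord_recl big_ord0 addr0 !mxE /= mulNr.
by congr (_ - _ * _); congr (_ _ _); exact: val_inj.
Qed.

Lemma rotation1 (R : realType) (a : R) (v : 'cV[R]_2) :
  (rotation a *m v) 1 0 = sin a * v 0 0 + cos a * v 1 0.
Proof.
rewrite mxE !big_ord_recl big_ord0 addr0 !mxE /=.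
by congr (_ + _ * _); congr (_ _ _); exact: val_inj.
Qed.

Lemma inner2_rotation (R : realType) (r a : R) (u v : 'cV[R]_2) :
  inner2 (r *: (rotation a *m u)) (r *: (rotation a *m v)) = r ^+ 2 * inner2 u v.
Proof.
rewrite /inner2 !scale_entry !rotation0 !rotation1.
rewrite -[RHS]mul1r -(cos2Dsin2 a); ring.
Qed.

Lemma cross2_rotation (R : realType) (r a : R) (u v : 'cV[R]_2) :
  cross2 (r *: (rotation a *m u)) (r *: (rotation a *m v)) = r ^+ 2 * cross2 u v.
Proof.
rewrite /cross2 !scale_entry !rotation0 !rotation1.
rewrite -[RHS]mul1r -(cos2Dsin2 a); ring.
Qed.

Lemma norm2_inner2 (R : realType) (u : 'cV[R]_2) : norm2 u = 1 -> inner2 u u = 1.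
Proof.
move=> u1; have : norm2 u ^+ 2 = 1 by rewrite u1 expr1n.
rewrite sqr_sqrtr; last by apply: sumr_ge0 => l _; exact: sqr_ge0.
move=> <-; rewrite !big_ord_recl big_ord0 addr0 /inner2 !expr2.
by congr (_ * _ + _ * _); congr (_ _ _); exact: val_inj.
Qed.

Lemma inner2_cross2 (R : realType) (u v : 'cV[R]_2) :
  inner2 u u = 1 -> inner2 v v = 1 -> inner2 u v ^+ 2 + cross2 u v ^+ 2 = 1.
Proof.
move=> u1 v1; transitivity (inner2 u u * inner2 v v); last by rewrite u1 v1 mulr1.
by rewrite /inner2 /cross2; ring.
Qed.

(** * Linear independence of powers of affine functions *)

(** With [f j u = (1 - c j * u) `^ e], the combination
    [- (1 - d * u) / e * f' j u - d * f j u] is [(c j - d) * (1 - c j * u) `^ (e - 1)].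
    One differentiation thus turns the relation into one of the same shape, with
    exponent [e - 1], from which the terms with [c j = d] have disappeared. *)
Lemma affine_powers_step (R : realType) n (c a : 'I_n -> R) (e x y d : R) :
  e != 0 ->
  (forall u, x < u < y -> forall j, 0 < 1 - c j * u) ->
  (forall u, x < u < y -> \sum_j a j * (1 - c j * u) `^ e = 0) ->
  forall u, x < u < y ->
    \sum_j a j * (c j - d) * (1 - c j * u) `^ (e - 1) = 0.
Proof.
move=> e0 pos vanish u uxy.
have isd : is_derive u 1 (\sum_(j < n) (fun v => a j * (1 - c j * v) `^ e))
    (\sum_(j < n) a j * (- c j * (e * (1 - c j * u) `^ (e - 1)))).
  apply: is_derive_sum => j.
  have inner : is_derive u 1 (fun v => 1 - c j * v) (- c j).
    have := is_deriveB (is_derive_cst (1 : R) u (1 : R))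
      (is_deriveZ (c j) (is_derive_id u (1 : R))).
    by rewrite sub0r [_ *: _]mulr1.
  have := @is_derive1_comp _ (@powR R ^~ e) (fun v => 1 - c j * v) u _ _
            (is_derive1_powR e (pos u uxy j)) inner.
  move=> /(is_deriveZ (a j)) H; apply: (is_derive_eq H).
  by rewrite /GRing.scale/= [_ * - c j]mulrC.
have deriv0 : \sum_(j < n) a j * (c j * (1 - c j * u) `^ (e - 1)) = 0.
  have : 'D_1 (\sum_(j < n) (fun v => a j * (1 - c j * v) `^ e)) u = 0.
    rewrite (@near_eq_derive _ _ _ _ (cst 0)) ?derive_cst//.
    have : \forall v \near u, v \in `]x, y[%R.
      by apply: near_in_itvoo; rewrite in_itv.
    apply: filterS => v; rewrite in_itv/= => vxy.
    by rewrite fct_sumE vanish.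
  rewrite (@derive_val _ _ _ _ _ _ _ isd) => H0.
  apply/eqP; have : - e * \sum_(j < n) a j * (c j * (1 - c j * u) `^ (e - 1)) = 0.
    by rewrite -[RHS]H0 mulr_sumr; apply: eq_bigr => j _; ring.
  by move/eqP; rewrite mulf_eq0 oppr_eq0 (negPf e0).
have powS j : (1 - c j * u) `^ e = (1 - c j * u) * (1 - c j * u) `^ (e - 1).
  have p := pos u uxy j.
  by rewrite -{2}(powRr1 (ltW p)) -powRD ?subrKC// (gt_eqF p) implybT.
transitivity ((1 - d * u) * \sum_(j < n) a j * (c j * (1 - c j * u) `^ (e - 1))
   - d * \sum_(j < n) a j * (1 - c j * u) `^ e).
  rewrite !mulr_sumr -sumrB; apply: eq_bigr => j _; rewrite powS; ring.
by rewrite deriv0 vanish// !mulr0 subr0.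
Qed.

Lemma affine_powers_iter (R : realType) n (c a : 'I_n -> R) (e x y : R)
    (ds : seq R) :
  e < 0 ->
  (forall u, x < u < y -> forall j, 0 < 1 - c j * u) ->
  (forall u, x < u < y -> \sum_j a j * (1 - c j * u) `^ e = 0) ->
  forall u, x < u < y ->
    \sum_j a j * (\prod_(d <- ds) (c j - d)) *
      (1 - c j * u) `^ (e - (size ds)%:R) = 0.
Proof.
move=> + pos; elim: ds a e => [|d ds IH] a e e0 vanish u uxy.
  by rewrite -[RHS](vanish u uxy); apply: eq_bigr => j _; rewrite big_nil mulr1 subr0.
have e1 : e - 1 < 0 by lra.
have := IH (fun j => a j * (c j - d)) _ e1
  (affine_powers_step d (ltr0_neq0 e0) pos vanish) u uxy.
move=> H; rewrite -[RHS]H; apply: eq_bigr => j _.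
rewrite big_cons mulrA.
by have -> : e - (size (d :: ds))%:R = e - 1 - (size ds)%:R by rewrite /= -natr1; ring.
Qed.

(** Distinct [c] give linearly independent functions [(1 - c * u) `^ e]: all values
    of [c] other than [d] are eliminated one after the other, and what remains is
    the sum in question times a nonzero number.  Indices with the same [c] give the
    same function, so only the sum of their coefficients is determined. *)
Lemma affine_powers_free (R : realType) n (c a : 'I_n -> R) (e x y d : R) :
  e < 0 -> x < y ->
  (forall u, x < u < y -> forall j, 0 < 1 - c j * u) ->
  (forall u, x < u < y -> \sum_j a j * (1 - c j * u) `^ e = 0) ->
  \sum_(j | c j == d) a j = 0.
Proof.
move=> e0 xy pos vanish.
have [j0 /eqP cj0|none] := pickP (fun j => c j == d); last first.
  by rewrite big_pred0.
pose ds := [seq z <- [seq c j | j <- enum 'I_n] | z != d].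
have uxy : x < (x + y) / 2 < y by lra.
have := affine_powers_iter ds e0 pos vanish uxy.
set u := (x + y) / 2; set e' := e - _ => iter0.
pose K := \prod_(z <- ds) (d - z) * (1 - d * u) `^ e'.
have K0 : K != 0.
  rewrite mulf_neq0//.
    rewrite prodf_seq_neq0; apply/allP => z; rewrite mem_filter => /andP[zd _].
    by rewrite subr_eq0 eq_sym.
  by rewrite gt_eqF// powR_gt0// -cj0 pos.
apply: (mulIf K0); rewrite mul0r -[RHS]iter0 mulr_suml.
rewrite [RHS](bigID (fun j => c j == d))/= [X in _ + X]big1 ?addr0.
  by apply: eq_bigr => j /eqP cj; rewrite cj -mulrA.
move=> j cj; have cjds : c j \in ds.
  by rewrite mem_filter cj map_f// mem_enum.
by rewrite (big_rem (c j))//= subrr mul0r mulr0 mul0r.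
Qed.

(** * Point sets on the circle stable under their own reflections *)

Lemma cos_eq1_small (R : realType) (x : R) :
  `|x| < 2 * pi -> cos x = 1 -> x = 0.
Proof.
move=> xlt cx.
have : cos ((x / 2) *+ 2) = 1 by rewrite -mulr_natr divfK.
rewrite cos_mulr2n cos2sin2 => s0.
have {}s0 : sin (x / 2) = 0.
  by apply/eqP; rewrite -sqrf_eq0; apply/eqP; lra.
have [x0|x0|//] := ltgtP x 0.
- have := @sin_gt0_pi R (- x / 2); rewrite mulNr sinN s0 oppr0 ltxx => H.
  by have : false by apply: H; rewrite ltr0_norm// in xlt; lra.
- have := @sin_gt0_pi R (x / 2); rewrite s0 ltxx => H.
  by have : false by apply: H; rewrite gtr0_norm// in xlt; lra.
Qed.

Lemma angle_unique (R : realType) (x y : R) :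
  `|x - y| < 2 * pi -> cos x = cos y -> sin x = sin y -> x = y.
Proof.
move=> xy cxy sxy; apply/eqP; rewrite -subr_eq0; apply/eqP.
by apply: cos_eq1_small => //; rewrite cosB cxy sxy -!expr2 cos2Dsin2.
Qed.

Lemma angle_exists (R : realType) (phi X Y : R) : X ^+ 2 + Y ^+ 2 = 1 ->
  exists x, [/\ 0 < x <= 2 * pi, X = cos (phi + x) & Y = sin (phi + x)].
Proof.
move=> XY1.
have base (C S : R) : C ^+ 2 + S ^+ 2 = 1 ->
    exists x, [/\ 0 < x <= 2 * pi, C = cos x & S = sin x].
  move=> CS1; have pi0 := @pi_gt0 R.
  have Cle : -1 <= C <= 1.
    rewrite -ler_norml -(@ler_pXn2r _ 2) ?nnegrE// expr1n real_normK ?num_real//.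
    have := sqr_ge0 S; lra.
  have /andP[a0 api] : 0 <= acos C <= pi by rewrite acos_ge0// acos_lepi.
  have cosa : cos (acos C) = C by rewrite acosK// in_itv.
  have sina : sin (acos C) = `|S|.
    by rewrite sin_acos// -CS1 addrAC subrr add0r sqrtr_sqr.
  have per (x : R) : cos (2 * pi + x) = cos x /\ sin (2 * pi + x) = sin x.
    by rewrite mulr_natl addrC cosD2pi sinD2pi.
  have [S0|S0] := ltP S 0.
    exists (2 * pi + - acos C); split; first by lra.
    + by rewrite (per _).1 cosN cosa.
    + by rewrite (per _).2 sinN sina ltr0_norm// opprK.
  have [a1|a1] := ltP 0 (acos C).
    exists (acos C); split; first by lra.
    + by rewrite cosa.
    + by rewrite sina ger0_norm.
  have {a0 a1}ac : acos C = 0 by lra.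
  exists (2 * pi + acos C); split; first by rewrite ac addr0 lexx andbT; lra.
  + by rewrite (per _).1 cosa.
  + by rewrite (per _).2 sina ger0_norm.
have cs := cos2Dsin2 phi.
have [|x [x0 cx sx]] := base (cos phi * X + sin phi * Y) (cos phi * Y - sin phi * X).
  rewrite -[RHS](mulr1 1) -{1}cs -XY1; ring.
exists x; split=> //.
- rewrite cosD -cx -sx -[LHS]mul1r -cs; ring.
- rewrite sinD -cx -sx -[LHS]mul1r -cs; ring.
Qed.

(** Reflecting in [0] and then in [delta] translates by [2 * delta]; applied to [0]
    and [delta], these translations give all the multiples.  Conversely, an element
    of [B] can be moved to some [r] with [0 <= r < 2 * delta], and minimality
    of [delta], applied to [r] and to its mirror image [2 * delta - r], leaves only
    [r = 0] and [r = delta]. *)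
Lemma reflection_closed_multiples (R : realType) (B : set R) (delta : R) :
  B 0 -> (forall a x, B a -> B x -> B (2 * a - x)) ->
  0 < delta -> B delta -> (forall x, B x -> 0 < x -> delta <= x) ->
  forall x, B x <-> exists k : int, x = k%:~R * delta.
Proof.
move=> B0 Brefl d0 Bd dmin.
have opp x : B x -> B (- x) by move/(Brefl _ _ B0); rewrite mulr0 sub0r.
have shift x (k : int) : B x -> B (x + (k%:~R) * (2 * delta)).
  move=> Bx; elim: k => [|k IH|k IH].
  - by rewrite mul0r addr0.
  - have := Brefl _ _ Bd (opp _ IH); congr (B _).
    by rewrite intS intrD; ring.
  - have := Brefl _ _ (opp _ Bd) (opp _ IH); congr (B _).
    by rewrite intS !mulrNz intrD; ring.
move=> x; split=> [Bx|[k ->]].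
  pose f := Num.floor (x / (2 * delta)).
  have d20 : 0 < 2 * delta by rewrite mulr_gt0.
  have := shift x (- f) Bx; set r := x + _ => Br.
  have r0 : 0 <= r.
    rewrite /r mulrNz mulNr subr_ge0 -ler_pdivlMr//; exact: floor_le_tmp.
  have r2 : r < 2 * delta.
    rewrite /r mulrNz mulNr ltrBlDr -{1}[2 * delta]mul1r -mulrDl -ltr_pdivrMr//.
    by rewrite addrC -[1]/(1%:~R) -intrD floorD1_gt.
  have [r00|r00] := eqVneq r 0.
    exists (f * 2); move: r00; rewrite /r => r00; rewrite intrM.
    by move: r00; rewrite mulrNz => ?; lra.
  have {}r0 : 0 < r by rewrite lt_def r00.
  have rd := dmin _ Br r0.
  have [rd'|rd'] := ltP delta r.
    have B2 := Brefl _ _ Bd Br.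
    by have := dmin _ B2; lra.
  exists (f * 2 + 1); rewrite intrD intrM.
  have : r = delta by lra.
  by rewrite /r mulrNz => ?; lra.
have -> : k = (k %/ 2)%Z * 2 + (k %% 2)%Z by exact: divz_eq.
have : ((k %% 2)%Z = 0) \/ ((k %% 2)%Z = 1).
  have := modz_ge0 k (isT : (2 : int) != 0).
  by have := ltz_pmod k (isT : (0 : int) < 2); case: (k %% 2)%Z => [[|[]]|]//; [left|right].
case=> ->.
- have := shift _ (k %/ 2)%Z B0; congr (B _); rewrite addr0 intrM; ring.
- have := shift _ (k %/ 2)%Z Bd; congr (B _); rewrite intrD intrM; ring.
Qed.

(** The two equations on [Q l] say that it is the mirror image of [Q j] in the line
    through [0] and [Q i].  The angles of the [Q j], measured from one of them, form
    a set [B] of reals that is stable under the point reflections in its own elements,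
    contains [2 * pi], and is finite modulo [2 * pi].  Hence [B] consists of the
    multiples of its least positive element [delta], where [2 * pi = N * delta] and
    [N] is the number of points. *)
Lemma reflection_closed_regular (R : realType) n (Q : 'I_n -> 'cV[R]_2) :
  (0 < n)%N -> (forall j, inner2 (Q j) (Q j) = 1) -> injective Q ->
  (forall i j, exists l, inner2 (Q i) (Q l) = inner2 (Q i) (Q j) /\
                         cross2 (Q i) (Q l) = - cross2 (Q i) (Q j)) ->
  regular_polygon Q.
Proof.
move=> n0 unitQ injQ reflQ; pose i0 := Ordinal n0; have pi0 := @pi_gt0 R.
pose at_angle (j : 'I_n) x := Q j 0 0 = cos x /\ Q j 1 0 = sin x.
have [phi atphi] : exists phi, at_angle i0 phi.
  have [|phi [_ c s]] := @angle_exists R 0 (Q i0 0 0) (Q i0 1 0).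
    by rewrite -[RHS](unitQ i0) /inner2; ring.
  by exists phi; rewrite /at_angle c s add0r.
have /choice[x xP] : forall j, exists x, 0 < x <= 2 * pi /\ at_angle j (phi + x).
  move=> j; have [|x [x0 c s]] := @angle_exists R phi (Q j 0 0) (Q j 1 0).
    by rewrite -[RHS](unitQ j) /inner2; ring.
  by exists x.
pose B : set R := [set x | exists j, at_angle j (phi + x)].
have B0 : B 0 by exists i0; rewrite /at_angle addr0.
have per (t : R) : cos (t + 2 * pi) = cos t /\ sin (t + 2 * pi) = sin t.
  by rewrite mulr_natl cosD2pi sinD2pi.
have B2pi : B (2 * pi).
  by exists i0; rewrite /at_angle (per _).1 (per _).2.
have Brefl a t : B a -> B t -> B (2 * a - t).
  move=> [i [ci si]] [j [cj sj]]; have [l [cl sl]] := reflQ i j.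
  exists l; rewrite /at_angle.
  have -> : phi + (2 * a - t) = (phi + a) + ((phi + a) - (phi + t)) by ring.
  pose d := (phi + a) - (phi + t); rewrite (cosD _ d) (sinD _ d) cosB sinB.
  rewrite /inner2 ci si cj sj in cl.
  rewrite /cross2 ci si cj sj in sl; have cs := cos2Dsin2 (phi + a).
  (* [cl] and [sl] give the coordinates of [Q l] in the frame turned by [phi + a];
     both identities below turn the frame back. *)
  split.
  - transitivity (Q l 0 0 * (cos (phi + a) ^+ 2 + sin (phi + a) ^+ 2)).
      by rewrite cs mulr1.
    transitivity (cos (phi + a) * (cos (phi + a) * Q l 0 0 + sin (phi + a) * Q l 1 0)
      - sin (phi + a) * (cos (phi + a) * Q l 1 0 - sin (phi + a) * Q l 0 0)).
      by ring.
    by rewrite cl sl; ring.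
  - transitivity (Q l 1 0 * (cos (phi + a) ^+ 2 + sin (phi + a) ^+ 2)).
      by rewrite cs mulr1.
    transitivity (sin (phi + a) * (cos (phi + a) * Q l 0 0 + sin (phi + a) * Q l 1 0)
      + cos (phi + a) * (cos (phi + a) * Q l 1 0 - sin (phi + a) * Q l 0 0)).
      by ring.
    by rewrite cl sl; ring.
(* Taking the angles in the half-open interval from 0 (excluded) to 2 pi (included)
   makes the least of them the least positive element of [B]; the base point
   itself is counted there with the angle 2 pi. *)
have [i1 _ i1min] := @arg_minP _ _ _ i0 predT x isT.
set delta := x i1 in i1min.
have /andP[d0 d2pi] : 0 < delta <= 2 * pi by have [] := xP i1.
have Bd : B delta by exists i1; have [] := xP i1.
have dmin t : B t -> 0 < t -> delta <= t.
  move=> [j [cj sj]] t0; have [xj [cxj sxj]] := xP j.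
  have [t2|t2] := ltP (2 * pi) t; first by lra.
  suff -> : t = x j by exact: i1min.
  apply: (addrI phi); apply: angle_unique; rewrite -?cxj -?sxj//.
  by rewrite opprD addrACA subrr add0r ltr_norml; lra.
have BE := reflection_closed_multiples B0 Brefl d0 Bd dmin.
have [N N0 Nd] : exists2 N : nat, (0 < N)%N & 2 * pi = N%:R * delta.
  have /BE[k kd] := B2pi.
  have : 0 < k%:~R :> R by rewrite -(pmulr_lgt0 _ d0) -kd mulr_gt0.
  by rewrite ltr0z; case: k kd => // N kd N0; exists N.
have /choice[g gP] : forall k : 'I_N, exists j, at_angle j (phi + k%:R * delta).
  by move=> k; have : B (k%:R * delta) by apply/BE; exists k.
have g_inj : injective g.
  move=> k l gkl; have [c1 s1] := gP k; have [c2 s2] := gP l.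
  have : phi + k%:R * delta = phi + l%:R * delta.
    apply: angle_unique; rewrite -?c1 -?s1 ?gkl -?c2 -?s2//.
    rewrite opprD addrACA subrr add0r -mulrBl normrM (gtr0_norm d0) Nd ltr_pM2r//.
    rewrite distrC.
    have kN : k%:R < N%:R :> R by rewrite ltr_nat.
    have lN : l%:R < N%:R :> R by rewrite ltr_nat.
    have k0 : 0 <= k%:R :> R by [].
    have l0 : 0 <= l%:R :> R by [].
    by rewrite ltr_norml; lra.
  move=> /addrI /(mulIf (lt0r_neq0 d0)) /eqP; rewrite eqr_nat => /eqP.
  exact: val_inj.
have g_surj j : exists k, g k = j.
  have [xj [cj sj]] := xP j; have : B (x j) by exists j.
  move=> /BE[k kd].
  have : 0 < k%:~R :> R by rewrite -(pmulr_lgt0 _ d0) -kd; lra.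
  rewrite ltr0z; case: k kd => // k kd _.
  have kN : (k <= N)%N.
    by rewrite -(ler_nat R) -(ler_pM2r d0) -Nd; rewrite kd in xj; lra.
  have [kN'|kN'] := ltnP k N.
    exists (Ordinal kN'); apply: injQ; have [c s] := gP (Ordinal kN').
    by apply: cV2P; rewrite ?c ?s ?cj ?sj kd.
  (* Here [k = N], that is angle 2 pi: this is the base point, vertex number 0. *)
  exists (Ordinal N0); apply: injQ; have [c s] := gP (Ordinal N0).
  have kdN : x j = 2 * pi by rewrite kd Nd; congr (_%:R * _); apply/eqP; rewrite eqn_leq kN.
  rewrite kdN ?(per _).1 ?(per _).2 in cj sj; rewrite /= mul0r addr0 in c s.
  by apply: cV2P; rewrite ?c ?s ?cj ?sj.
have NE : N = n.
  have /card_codom : injective g by [].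
  rewrite card_ord => <-; rewrite -[RHS]card_ord; apply: eq_card => j.
  by have [k <-] := g_surj j; rewrite codom_f.
subst N; exists (perm g_inj), phi => j; rewrite permE.
have -> : 2 * pi * j%:R / n%:R = j%:R * delta :> R.
  by rewrite Nd; field; rewrite pnatr_eq0 -lt0n.
exact: gP.
Qed.

(** * Second derivatives of plane motions *)

Lemma derive1_coord (R : realType) d (f : R -> 'cV[R]_d) (l : 'I_d) t :
  derivable f t 1 -> derive1 (fun s => f s l 0) t = derive1 f t l 0.
Proof.
by move=> df; rewrite (derive1E f t) (derive_mx df) mxE derive1E.
Qed.

Lemma derivable_coord (R : realType) d (f : R -> 'cV[R]_d) (l : 'I_d) t :
  derivable f t 1 -> derivable (fun s => f s l 0) t 1.
Proof. by move=> /derivable_mxP /(_ l 0). Qed.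

Lemma twice_differentiable_coord (R : realType) (I : set R) d (f : R -> 'cV[R]_d)
    (l : 'I_d) :
  open I -> twice_differentiable_on I f ->
  twice_differentiable_on I (fun t => f t l 0) /\
  forall t, I t -> derive1n 2 (fun s => f s l 0) t = derive1n 2 f t l 0.
Proof.
move=> oI df.
have nearI t : I t -> {near t, (fun s => derive1 f s l 0) =1
                               derive1 (fun s => f s l 0)}.
  move=> It; have : nbhs t I by apply: open_nbhs_nbhs.
  by apply: filterS => s Is /=; rewrite derive1_coord//; have [] := df s Is.
split=> t It; have [df1 df2] := df t It.
  split; first exact: derivable_coord.
  by apply: (near_eq_derivable (nearI t It)); exact: derivable_coord.
rewrite /derive1n/= -(derive1_coord l df2) (derive1E (fun s => derive1 f s l 0)).
by rewrite (near_eq_derive (1 : R) (nearI t It)) derive1E.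
Qed.

Lemma derive2_lincomb (R : realType) (I : set R) (f g h : R -> R) (a b : R) :
  open I -> twice_differentiable_on I f -> twice_differentiable_on I g ->
  (forall t, I t -> h t = a * f t + b * g t) ->
  forall t, I t -> derive1n 2 h t = a * derive1n 2 f t + b * derive1n 2 g t.
Proof.
move=> oI df dg hE.
have step (f0 g0 h0 : R -> R) t : I t ->
    (forall t, I t -> h0 t = a * f0 t + b * g0 t) ->
    derivable f0 t 1 -> derivable g0 t 1 ->
    derive1 h0 t = a * derive1 f0 t + b * derive1 g0 t.
  move=> It h0E df0 dg0; rewrite !derive1E.
  have dE := is_deriveD (is_deriveZ a (derivableP df0)) (is_deriveZ b (derivableP dg0)).
  rewrite -[RHS](@derive_val _ _ _ _ _ _ _ dE); apply: near_eq_derive.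
  have : nbhs t I by apply: open_nbhs_nbhs.
  by apply: filterS => s /h0E.
move=> t It; have [_ df2] := df t It; have [_ dg2] := dg t It.
apply: (step (derive1 f) (derive1 g) (derive1 h) t It _ df2 dg2) => s Is.
have [df1 _] := df s Is; have [dg1 _] := dg s Is.
exact: (step f g h s Is hE df1 dg1).
Qed.

(** The torque of a plane motion is invariant under a constant rotation of the
    plane, here the one of cosine [C] and sine [S]. *)
Lemma torque_rotation (R : realType) (I : set R) (X Y X' Y' : R -> R) (C S : R) :
  open I -> twice_differentiable_on I X -> twice_differentiable_on I Y ->
  C ^+ 2 + S ^+ 2 = 1 ->
  (forall t, I t -> X' t = C * X t - S * Y t) ->
  (forall t, I t -> Y' t = S * X t + C * Y t) ->
  forall t, I t ->
    X' t * derive1n 2 Y' t - Y' t * derive1n 2 X' t =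
    X t * derive1n 2 Y t - Y t * derive1n 2 X t.
Proof.
move=> oI dX dY CS X'E Y'E t It.
have X'E' s : I s -> X' s = C * X s + - S * Y s by move/X'E ->; ring.
rewrite (derive2_lincomb oI dX dY X'E' It) (derive2_lincomb oI dX dY Y'E It).
rewrite (X'E t It) (Y'E t It).
move: (derive1n 2 X t) (derive1n 2 Y t) => X2 Y2.
transitivity ((C ^+ 2 + S ^+ 2) * (X t * Y2 - Y t * X2)); first by ring.
by rewrite CS mul1r.
Qed.

(** * Torques and denominators of rotopulsating orbits *)

Lemma sigma_pm1 (R : realType) (kappa : R) :
  kappa = -1 \/ kappa = 1 -> sigma kappa = kappa.
Proof.
by case=> ->; rewrite /sigma ?eqxx//; case: eqP => // ?; lra.
Qed.

Lemma odot_sym (R : realType) (kappa : R) d (x y : 'cV[R]_d) :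
  odot kappa x y = odot kappa y x.
Proof. by apply: eq_bigr => l _; rewrite [x l 0 * _]mulrC. Qed.

Definition planar_index (k : nat) (k_ge2 : (2 <= k)%N) (a : 'I_2) : 'I_k :=
  cast_ord (subnKC k_ge2) (lshift (k - 2) a).

Lemma stack_planar (R : realType) k (k_ge2 : (2 <= k)%N) (x : 'cV[R]_2) z a :
  stack k_ge2 x z (planar_index k_ge2 a) 0 = x a 0.
Proof.
rewrite /stack castmxE /planar_index cast_ordK cast_ord_id; exact: col_mxEu.
Qed.

(** As [3 <= k], the coordinate that carries the sign is the last one of [z]. *)
Lemma odot_stack (R : realType) (kappa : R) k (k_ge3 : (3 <= k)%N)
    (x y : 'cV[R]_2) (z w : 'cV[R]_(k - 2)) :
  odot kappa (stack (ltnW k_ge3) x z) (stack (ltnW k_ge3) y w) =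
  inner2 x y + odot kappa z w.
Proof.
rewrite /odot (reindex (cast_ord (subnKC (ltnW k_ge3)))); last first.
  apply: onW_bij; exists (cast_ord (esym (subnKC (ltnW k_ge3)))).
    exact: cast_ordK.
  exact: cast_ordKV.
rewrite big_split_ord/=; congr (_ + _).
  transitivity (\sum_(a < 2) x a 0 * y a 0).
    apply: eq_bigr => a _; rewrite !stack_planar ltn_eqF ?mul1r//.
    exact: (@leq_trans 3 a.+2 k (ltn_ord a) k_ge3).
  rewrite !big_ord_recl big_ord0 addr0 /inner2.
  by congr (_ * _ + _ * _); congr (_ _ _); exact: val_inj.
apply: eq_bigr => l _; rewrite /stack !castmxE !cast_ordK !cast_ord_id !col_mxEd.
congr (_ * _); congr (if _ then _ else _).
by rewrite -[RHS](eqn_add2l 2) addnS (subnKC (ltnW k_ge3)).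
Qed.

(** If [L] is the common value of the row sums, weighting the rows with [m] gives
    [(\sum_k m k) * L], while antisymmetry makes this weighted total equal to its
    own opposite. *)
Lemma antisymmetric_rows_zero (R : realFieldType) n (m : 'I_n -> R)
    (w : 'I_n -> 'I_n -> R) :
  (forall i, 0 < m i) -> (forall i j, w j i = - w i j) ->
  (forall i i', \sum_j m j * w i j = \sum_j m j * w i' j) ->
  forall i, \sum_j m j * w i j = 0.
Proof.
move=> m0 anti rows i.
have tot0 : \sum_k m k * (\sum_j m j * w k j) = 0.
  suff : \sum_k m k * (\sum_j m j * w k j) =
         - \sum_k m k * (\sum_j m j * w k j) by lra.
  rewrite -sumrN; under eq_bigr do rewrite mulr_sumr.
  rewrite exchange_big; apply: eq_bigr => j _.
  rewrite mulr_sumr -sumrN; apply: eq_bigr => k _; rewrite anti; ring.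
have M0 : 0 < \sum_k m k.
  by rewrite (bigD1 i)//= ltr_wpDr// sumr_ge0// => k _; rewrite ltW.
apply: (mulfI (lt0r_neq0 M0)); rewrite mulr0 -[RHS]tot0 mulr_suml.
by apply: eq_bigr => k _; rewrite (rows i k).
Qed.

(** Every term of the acceleration that is proportional to [x i] contributes nothing
    to the torque about the origin; the term [j = i] of the right-hand side is zero,
    so that the sum can range over all [j]. *)
Lemma acceleration_torque (R : realType) (kappa : R) n d (m : 'I_n -> R)
    (x v : 'I_n -> 'cV[R]_d) (i : 'I_n) (a b : 'I_d) :
  x i a 0 * acceleration kappa m x v i b 0 - x i b 0 * acceleration kappa m x v i a 0 =
  \sum_j m j * ((x i a 0 * x j b 0 - x i b 0 * x j a 0) / denominator kappa (x i) (x j)).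
Proof.
have accE l : acceleration kappa m x v i l 0 =
    \sum_(j < n | j != i) m j / denominator kappa (x i) (x j) *
      (x j l 0 - sigma kappa * odot kappa (x i) (x j) * x i l 0)
    - sigma kappa * odot kappa (v i) (v i) * x i l 0.
  rewrite /acceleration !mxE summxE; congr (_ - _).
  by apply: eq_bigr => j _; rewrite !mxE.
rewrite !accE [RHS](bigD1 i)//= [x i b 0 * x i a 0]mulrC subrr mul0r mulr0 add0r.
set F := fun l => \sum_(j < n | j != i) m j / denominator kappa (x i) (x j) *
      (x j l 0 - sigma kappa * odot kappa (x i) (x j) * x i l 0).
rewrite -/(F a) -/(F b); transitivity (x i a 0 * F b - x i b 0 * F a); first by ring.
rewrite /F !mulr_sumr -sumrB; apply: eq_bigr => j _; ring.
Qed.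

(** The planar part of the body [j] is that of the body [i] turned by the fixed angle
    from [Q i] to [Q j], so all bodies have the same torque; by action and reaction,
    the torques weighted with the masses add up to zero. *)
Lemma torque_zero (R : realType) (n k : nat) (kappa : R) (m : 'I_n -> R)
  (k_ge3 : (3 <= k)%N) (m_gt0 : forall i, 0 < m i)
  (I : set R) (q : 'I_n -> R -> 'cV[R]_k) (rho theta : R -> R)
  (Z : R -> 'cV[R]_(k - 2)) (Q : 'I_n -> 'cV[R]_2) :
  rotopulsating kappa (ltnW k_ge3) m I q rho theta Z Q ->
  forall t, I t -> rho t != 0 -> forall i,
    \sum_j m j * (cross2 (Q i) (Q j) / denominator kappa (q i t) (q j t)) = 0.
Proof.
move=> [[[oI _ _] dq _ _ eqn] _ _ [_ norm1] qE] t It rho0.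
pose pl := planar_index (ltnW k_ge3).
have unitQ i : inner2 (Q i) (Q i) = 1 by apply: norm2_inner2.
pose p i s : 'cV[R]_2 := rho s *: (rotation (theta s) *m Q i).
have qp i s a : I s -> q i s (pl a) 0 = p i s a 0.
  by move=> Is; rewrite qE// stack_planar.
have pE i s : I s ->
    q i s (pl 0) 0 = rho s * (cos (theta s) * Q i 0 0 - sin (theta s) * Q i 1 0) /\
    q i s (pl 1) 0 = rho s * (sin (theta s) * Q i 0 0 + cos (theta s) * Q i 1 0).
  by move=> Is; rewrite !qp// /p !scale_entry rotation0 rotation1.
pose tau i := q i t (pl 0) 0 * derive1n 2 (q i) t (pl 1) 0 -
              q i t (pl 1) 0 * derive1n 2 (q i) t (pl 0) 0.
have tauE i : tau i = rho t ^+ 2 *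
    \sum_j m j * (cross2 (Q i) (Q j) / denominator kappa (q i t) (q j t)).
  rewrite /tau eqn// acceleration_torque mulr_sumr; apply: eq_bigr => j _.
  rewrite !qp// -/(cross2 (p i t) (p j t)) cross2_rotation; ring.
have tau_const i j : tau i = tau j.
  have coord l a := twice_differentiable_coord (pl a) oI (dq l).
  have tauD l : tau l =
      q l t (pl 0) 0 * derive1n 2 (fun s => q l s (pl 1) 0) t -
      q l t (pl 1) 0 * derive1n 2 (fun s => q l s (pl 0) 0) t.
    by rewrite /tau -((coord l 0).2 t It) -((coord l 1).2 t It).
  rewrite (tauD i) (tauD j).
  apply: (@torque_rotation _ I (fun s => q j s (pl 0) 0) (fun s => q j s (pl 1) 0)
    (fun s => q i s (pl 0) 0) (fun s => q i s (pl 1) 0) (inner2 (Q j) (Q i))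
    (cross2 (Q j) (Q i)) oI (coord j 0).1 (coord j 1).1 _ _ _ t It).
  - exact: inner2_cross2.
  - move=> s Is; have [xi yi] := pE i s Is; have [xj yj] := pE j s Is.
    rewrite xi xj yj.
    transitivity (inner2 (Q j) (Q j) *
       (rho s * (cos (theta s) * Q i 0 0 - sin (theta s) * Q i 1 0))).
      by rewrite unitQ mul1r.
    by rewrite /inner2 /cross2; ring.
  - move=> s Is; have [xi yi] := pE i s Is; have [xj yj] := pE j s Is.
    rewrite yi xj yj.
    transitivity (inner2 (Q j) (Q j) *
       (rho s * (sin (theta s) * Q i 0 0 + cos (theta s) * Q i 1 0))).
      by rewrite unitQ mul1r.
    by rewrite /inner2 /cross2; ring.
apply: antisymmetric_rows_zero => // i j.
  by rewrite cross2_anti mulNr /denominator odot_sym.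
have r20 : rho t ^+ 2 != 0 by rewrite expf_neq0.
by apply: (mulfI r20); rewrite -!tauE.
Qed.

(** Subtracting the constraints on the curved space eliminates [Z] and leaves
    [odot (q i) (q j) = kappa - rho ^+ 2 * c], so the base of the power in the
    denominator is [2 * rho ^+ 2 * c * (1 - c * u)].  This is nonnegative: for
    [kappa = 1] because [rho ^+ 2 <= 1] and [c <= 2], for [kappa = -1] because [u <= 0].
    It is nonzero on a solution, so all its factors are positive. *)
Lemma denominator_factor (R : realType) (n k : nat) (kappa : R) (m : 'I_n -> R)
  (k_ge3 : (3 <= k)%N) (kappa_pm1 : kappa = -1 \/ kappa = 1)
  (I : set R) (q : 'I_n -> R -> 'cV[R]_k) (rho theta : R -> R)
  (Z : R -> 'cV[R]_(k - 2)) (Q : 'I_n -> 'cV[R]_2) :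
  rotopulsating kappa (ltnW k_ge3) m I q rho theta Z Q ->
  forall t, I t -> forall i j, j != i ->
    let c := 1 - inner2 (Q i) (Q j) in
    let u := kappa * rho t ^+ 2 / 2 in
    [/\ 0 < rho t, 0 < c, 0 < 1 - c * u &
      denominator kappa (q i t) (q j t) =
        (2 * rho t ^+ 2) `^ (3 / 2) * (c `^ (3 / 2) * (1 - c * u) `^ (3 / 2))].
Proof.
move=> [[_ _ qM Dne _] [_ rho_ge0] _ [_ norm1] qE] t It i j ji c u.
have unitQ l : inner2 (Q l) (Q l) = 1 by apply: norm2_inner2.
have sk := sigma_pm1 kappa_pm1.
have kk : kappa ^+ 2 = 1 by case: kappa_pm1 => ->; rewrite ?sqrrN expr1n.
set zz := odot kappa (Z t) (Z t).
have zzE : rho t ^+ 2 + zz = kappa.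
  have := qM i t It; rewrite /Mspace/= qE// odot_stack inner2_rotation unitQ mulr1 -/zz.
  by move=> H; rewrite -[LHS]mul1r -kk expr2 -mulrA H mulr1.
have qq : odot kappa (q i t) (q j t) = kappa - rho t ^+ 2 * c.
  by rewrite !qE// odot_stack inner2_rotation -/zz -zzE /c; ring.
have baseE : sigma kappa - sigma kappa * odot kappa (q i t) (q j t) ^+ 2 =
    (2 * rho t ^+ 2) * (c * (1 - c * u)).
  rewrite sk qq /u; transitivity (kappa - kappa ^+ 2 * kappa
     + kappa ^+ 2 * (2 * rho t ^+ 2 * c) - kappa * (rho t ^+ 2 * c) ^+ 2); first by ring.
  by rewrite kk; field.
have r2 := sqr_ge0 (rho t).
have c02 : 0 <= c <= 2.
  have := inner2_cross2 (unitQ i) (unitQ j); have := sqr_ge0 (cross2 (Q i) (Q j)).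
  rewrite /c => H1 H2; have : inner2 (Q i) (Q j) ^+ 2 <= 1 by lra.
  move: (inner2 _ _) => C C1; have : `|C| <= 1.
    by rewrite -(@ler_pXn2r _ 2) ?nnegrE// expr1n real_normK ?num_real.
  by rewrite ler_norml; lra.
have cu : 0 <= 1 - c * u.
  case: kappa_pm1 => kE; first by rewrite /u kE; nra.
  have zz0 : 0 <= zz.
    apply: sumr_ge0 => l _; rewrite sk kE; case: ifP => _;
      rewrite mul1r -expr2; exact: sqr_ge0.
  by rewrite /u kE; rewrite kE in zzE; nra.
have /andP[c0 c2] := c02.
have := Dne i j t ji It; rewrite /denominator baseE powR_eq0.
have -> : (3 / 2 != 0 :> R) by lra.
rewrite andbT !mulf_eq0 !negb_or => /andP[/andP[_ r0] /andP[cn0 cun0]].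
split.
- by case/andP: r0 => r0 _; rewrite lt_def r0 rho_ge0.
- by rewrite lt_def cn0.
- by rewrite lt_def cun0.
- by rewrite (powRM _ _ (mulr_ge0 c0 cu)) ?(powRM _ c0 cu)// mulr_ge0.
Qed.

Theorem theorem1p1 (R : realType) (n k : nat) (kappa : R) (m : 'I_n -> R)
  (n_ge2 : (2 <= n)%N) (k_ge3 : (3 <= k)%N)
  (kappa_pm1 : kappa = -1 \/ kappa = 1)
  (m_gt0 : forall i, 0 < m i)
  (I : set R) (q : 'I_n -> R -> 'cV[R]_k) (rho theta : R -> R)
  (Z : R -> 'cV[R]_(k - 2)) (Q : 'I_n -> 'cV[R]_2)
  (q_rotopulsating : rotopulsating kappa (ltnW k_ge3) m I q rho theta Z Q)
  (rho_nonconstant : exists s t, [/\ I s, I t & rho s != rho t]) :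
  regular_polygon Q.
Proof.
have torque := torque_zero m_gt0 q_rotopulsating.
have denom := denominator_factor kappa_pm1 q_rotopulsating.
have [[[oI itvI I0] _ _ _ _] [[drho _] rho_ge0] _ [_ norm1] _] := q_rotopulsating.
have unitQ i : inner2 (Q i) (Q i) = 1 by apply: norm2_inner2.
have n_gt0 : (0 < n)%N by apply: ltnW.
pose c i j := 1 - inner2 (Q i) (Q j).
pose u t := kappa * rho t ^+ 2 / 2.
have c_pos i j : j != i -> 0 < c i j by move=> /(denom 0 I0)[].
have c_refl i : c i i = 0 by rewrite /c unitQ subrr.
have injQ : injective Q.
  move=> i j Qij; apply/eqP; apply: contraTT isT => ij.
  by have := c_pos j i ij; rewrite /c Qij unitQ subrr ltxx.
have rho_gt0 t : I t -> 0 < rho t.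
  move=> It; have := denom t It (Ordinal n_gt0) (Ordinal n_ge2) isT.
  by case.
have cu_pos t i j : I t -> 0 < 1 - c i j * u t.
  move=> It; have [->|ji] := eqVneq j i; first by rewrite c_refl mul0r subr0.
  by have [] := denom t It i j ji.
pose w i j := m j * cross2 (Q i) (Q j) * c i j `^ (- (3 / 2)).
have vanish t i : I t -> \sum_j w i j * (1 - c i j * u t) `^ (- (3 / 2)) = 0.
  move=> It; have r0 := rho_gt0 t It.
  have K0 : (2 * rho t ^+ 2) `^ (3 / 2) != 0.
    by rewrite gt_eqF// powR_gt0// mulr_gt0// exprn_gt0.
  apply: (mulfI (invr_neq0 K0)); rewrite mulr0 -[RHS](torque t It (lt0r_neq0 r0) i).
  rewrite mulr_sumr; apply: eq_bigr => j _; rewrite /w.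
  have [->|ji] := eqVneq j i; first by rewrite cross2_xx; ring.
  have [_ _ _ ->] := denom t It i j ji.
  by rewrite !powRN !invfM -/(c i j) -/(u t); ring.
(* As [rho] is nonnegative, it can be recovered from [u]; so [u] is not constant
   either, and by continuity takes all values between two different ones. *)
have [x [y [xy hit]]] : exists x y, x < y /\
    forall v, x < v < y -> exists2 t, I t & u t = v.
  have [s [t [Is It rst]]] := rho_nonconstant.
  wlog st : s t Is It rst / s <= t.
    move=> wl; have [|/ltW] := leP s t; first exact: wl Is It rst.
    by apply: wl It Is _; rewrite eq_sym.
  have stI r : r \in `[s, t]%R -> I r.
    by rewrite in_itv/= => srt; exact: itvI Is It _ srt.
  have ust : u s != u t.
    rewrite /u -subr_eq0 -mulrBl -mulrBr mulf_neq0// mulf_neq0//.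
      by case: kappa_pm1 => ->; rewrite ?oppr_eq0 oner_eq0.
    by rewrite subr_eq0 eqrXn2// rho_ge0.
  have ucont : {within `[s, t], continuous u}.
    apply: continuous_in_subspaceT => r /set_mem/= /stI Ir.
    have rc : {for r, continuous rho}.
      by apply/differentiable_continuous/derivable1_diffP; have [] := drho r Ir.
    rewrite /u; apply: cvgMl; apply: cvgMr.
    exact: (continuous_comp rc (@exprn_continuous _ _ _)).
  exists (Num.min (u s) (u t)), (Num.max (u s) (u t)); split.
    by rewrite gt_min !lt_max; case: (ltgtP (u s) (u t)) ust; rewrite ?orbT.
  move=> v /andP[v1 v2]; have [|r rst' <-] := @IVT _ u s t v st ucont.
    by rewrite !ltW.
  by exists r => //; exact: stI.
have level i d : \sum_(j | c i j == d) w i j = 0.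
  apply: (@affine_powers_free _ _ _ _ (- (3 / 2)) x y) => //.
  - by move=> v /hit[t It <-] j; exact: cu_pos.
  - by move=> v /hit[t It <-]; exact: vanish.
(* If [Q j] lies on the axis, it is its own mirror image.  Otherwise the terms of
   [level i (c i j)] cannot all have the sign of [cross2 (Q i) (Q j)]. *)
apply: reflection_closed_regular => // i j.
have [s0|s0] := eqVneq (cross2 (Q i) (Q j)) 0.
  by exists j; rewrite s0 oppr0.
have cij : 0 < c i j.
  by apply: c_pos; apply: contra_neq s0 => ->; exact: cross2_xx.
have [l /andP[/eqP cl sl]] : exists l, (c i l == c i j) &&
    (cross2 (Q i) (Q j) * cross2 (Q i) (Q l) < 0).
  apply/existsP; rewrite -[X in is_true X]negbK negb_exists.
  apply/negP => /forallP noneg.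
  have : 0 < \sum_(l | c i l == c i j) cross2 (Q i) (Q j) * w i l.
    have wE l : cross2 (Q i) (Q j) * w i l =
        m l * (cross2 (Q i) (Q j) * cross2 (Q i) (Q l) * c i l `^ (- (3 / 2))).
      by rewrite /w; ring.
    rewrite (bigD1 j)//= ltr_wpDr//.
      apply: sumr_ge0 => l /andP[/eqP cl _].
      have := noneg l; rewrite cl eqxx/= -leNgt => ge0.
      by rewrite wE mulr_ge0 ?(ltW (m_gt0 l))// mulr_ge0// powR_ge0.
    rewrite wE mulr_gt0// mulr_gt0 ?powR_gt0//.
    by rewrite -expr2 lt_def sqrf_eq0 s0 sqr_ge0.
  by rewrite -mulr_sumr level mulr0 ltxx.
have cE : inner2 (Q i) (Q l) = inner2 (Q i) (Q j) by move: cl; rewrite /c; lra.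
exists l; split=> //.
have hl := inner2_cross2 (unitQ i) (unitQ l).
have hj := inner2_cross2 (unitQ i) (unitQ j).
have : (cross2 (Q i) (Q l) - cross2 (Q i) (Q j)) *
       (cross2 (Q i) (Q l) + cross2 (Q i) (Q j)) = 0.
  by rewrite cE in hl; nra.
move=> /eqP; rewrite mulf_eq0 subr_eq0 addr_eq0 => /orP[/eqP e|/eqP//].
by have := sqr_ge0 (cross2 (Q i) (Q j)); rewrite e in sl; nra.
Qed.
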